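(* Let $f:[a;b]\to\mathbb{R}$ be a càdlàg function, $c>0$, and let $f^{i,c}=f_U^c-f_D^c:[a;b]\to\mathbb{R}$, with $f_U^c,f_D^c$ constructed from $f$ and $c$ as in the context. If $g:[a;b]\to\mathbb{R}$ is such that $$\sup_{a\le u<s\le b}\left|\{g(s)-g(u)\}-\{f(s)-f(u)\}\right|\le c$$ and $g$ has finite total variation, then for every $s\in[a;b]$ $$TV(g,[a;s])\ge TV(f^{i,c},[a;s]).$$ Moreover, $f^{i,c}$ is unique in the following sense: if, in addition, $g(a)=0$ and for every $s\in[a;b]$ the opposite inequality $TV(g,[a;s])\le TV(f^{i,c},[a;s])$ holds, then $g=f^{i,c}$.
   Context: Let $-\infty<a<b<+\infty$; $TV(g,[a;s])=\sup_n\sup_{a\le t_0<\dots<t_n\le s}\sum_{i=1}^n|g(t_i)-g(t_{i-1})|$ (equal to $0$ for $s=a$). Construction of $f_U^c,f_D^c:[a;b]\to[0;+\infty)$ (with $\inf\emptyset=\infty$). Let $T_D^cf=\inf\{s\in[a;b]:\sup_{t\in[a;s]}f(t)-f(s)\ge c\}$ and $T_U^cf=\inf\{s\in[a;b]:f(s)-\inf_{t\in[a;s]}f(t)\ge c\}$. Case $T_D^cf\ge T_U^cf$ (including both infinite). Put $T_{D,-1}^c=a$, $T_{U,0}^c=T_U^cf$ and for $k=0,1,2,\dots$: $T_{D,k}^c=\inf\{s\in[T_{U,k}^c;b]:\sup_{t\in[T_{U,k}^c;s]}f(t)-f(s)\ge c\}$ if $T_{U,k}^c<b$, and $T_{D,k}^c=\infty$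 if $T_{U,k}^c\ge b$; $T_{U,k+1}^c=\inf\{s\in[T_{D,k}^c;b]:f(s)-\inf_{t\in[T_{D,k}^c;s]}f(t)\ge c\}$ if $T_{D,k}^c<b$, and $T_{U,k+1}^c=\infty$ if $T_{D,k}^c\ge b$. (Only finitely many of these times are finite.) For $k$ with $T_{D,k-1}^c<\infty$ put $m_k^c(s)=\inf_{t\in[T_{D,k-1}^c;s]}f(t)$ for $s\in[T_{D,k-1}^c;T_{U,k}^c)\cap[a;b]$ and $m_k^c=\inf_{t\in[T_{D,k-1}^c;T_{U,k}^c)\cap[a;b]}f(t)$; for $k$ with $T_{U,k}^c<\infty$ put $M_k^c(s)=\sup_{t\in[T_{U,k}^c;s]}f(t)$ for $s\in[T_{U,k}^c;T_{D,k}^c)\cap[a;b]$ and $M_k^c=\sup_{t\in[T_{U,k}^c;T_{D,k}^c)\cap[a;b]}f(t)$. Define $f_U^c(s)=f_D^c(s)=0$ for $s\in[a;T_{U,0}^c)\cap[a;b]$; for $s\in[T_{U,k}^c;T_{D,k}^c)\cap[a;b]$: $f_U^c(s)=\sum_{i=0}^{k-1}(M_i^c-m_i^c-c)+M_k^c(s)-m_k^c-c$ and $f_D^c(s)=\sum_{i=0}^{k-1}(M_i^c-m_{i+1}^c-c)$; for $s\in[T_{D,k}^c;T_{U,k+1}^c)\cap[a;b]$: $f_U^c(s)=\sum_{i=0}^{k}(M_i^c-m_i^c-c)$ and $f_D^c(s)=\sum_{i=0}^{k-1}(M_i^c-m_{i+1}^c-c)+M_k^c-m_{k+1}^c(s)-c$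 ($k=0,1,2,\dots$). Case $T_D^cf<T_U^cf$. Put $S_{U,-1}^c=a$, $S_{D,0}^c=T_D^cf$ and for $k=0,1,2,\dots$: $S_{U,k}^c=\inf\{s\in[S_{D,k}^c;b]:f(s)-\inf_{t\in[S_{D,k}^c;s]}f(t)\ge c\}$ if $S_{D,k}^c<b$, and $S_{U,k}^c=\infty$ if $S_{D,k}^c\ge b$; $S_{D,k+1}^c=\inf\{s\in[S_{U,k}^c;b]:\sup_{t\in[S_{U,k}^c;s]}f(t)-f(s)\ge c\}$ if $S_{U,k}^c<b$, and $S_{D,k+1}^c=\infty$ if $S_{U,k}^c\ge b$. (Only finitely many of these times are finite.) For $k$ with $S_{U,k-1}^c<\infty$ put $N_k^c(s)=\sup_{t\in[S_{U,k-1}^c;s]}f(t)$ for $s\in[S_{U,k-1}^c;S_{D,k}^c)\cap[a;b]$ and $N_k^c=\sup_{t\in[S_{U,k-1}^c;S_{D,k}^c)\cap[a;b]}f(t)$; for $k$ with $S_{D,k}^c<\infty$ put $n_k^c(s)=\inf_{t\in[S_{D,k}^c;s]}f(t)$ for $s\in[S_{D,k}^c;S_{U,k}^c)\cap[a;b]$ and $n_k^c=\inf_{t\in[S_{D,k}^c;S_{U,k}^c)\cap[a;b]}f(t)$. Define $f_U^c(s)=f_D^c(s)=0$ for $s\in[a;S_{D,0}^c)\cap[a;b]$; for $s\in[S_{D,k}^c;S_{U,k}^c)\cap[a;b]$: $f_D^c(s)=\sum_{i=0}^{k-1}(N_i^c-n_i^c-c)+N_k^c-n_k^c(s)-c$ and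 $f_U^c(s)=\sum_{i=0}^{k-1}(N_{i+1}^c-n_i^c-c)$; for $s\in[S_{U,k}^c;S_{D,k+1}^c)\cap[a;b]$: $f_D^c(s)=\sum_{i=0}^{k}(N_i^c-n_i^c-c)$ and $f_U^c(s)=\sum_{i=0}^{k-1}(N_{i+1}^c-n_i^c-c)+N_{k+1}^c(s)-n_k^c-c$ ($k=0,1,2,\dots$). (Equivalently, $f_U^c=(-f)_D^c$ and $f_D^c=(-f)_U^c$.) *)

(* Defs.v *)
From HB Require Import structures.
From mathcomp Require Import all_boot all_order all_algebra.
From mathcomp Require Import all_classical all_reals all_analysis.

Set Implicit Arguments.
Unset Strict Implicit.
Unset Printing Implicit Defensive.

Import Order.TTheory GRing.Theory Num.Theory.
Import numFieldNormedType.Exports.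

Local Open Scope classical_set_scope.
Local Open Scope ring_scope.

(* Functions on [a; b] are represented by total functions R -> R; at points of
   [a; b] nothing below depends on their values elsewhere. *)

Definition cadlag_on (R : realType) (a b : R) (f : R -> R) : Prop :=
  (forall s, a <= s -> s < b -> f t @[t --> s^'+] --> f s) /\
  (forall s, a < s -> s <= b -> cvg (f t @[t --> s^'-])).

Definition increment_dist (R : realType) (a b : R) (g f : R -> R) : \bar R :=
  ereal_sup [set (`|(g us.2 - g us.1) - (f us.2 - f us.1)|)%:E | us in
    [set us : R * R | [/\ a <= us.1, us.1 < us.2 & us.2 <= b]]].

Section Construction.
Variables (R : realType) (a b c : R) (f : R -> R).

(* Times are extended reals, so that the infimum of the empty set is +oo.
   [window T s] is [T; s] and [stretch T T'] is [T; T') `&` [a; b].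
   Levels of f use the real [sup] and [inf], which default to 0 only on empty
   or unbounded sets; a cadlag f is bounded on [a; b]. *)
Definition window (T : \bar R) (s : R) : set R :=
  [set t | (T <= t%:E)%E /\ t <= s].

Definition stretch (T T' : \bar R) : set R :=
  [set t | a <= t <= b /\ (T <= t%:E < T')%E].

Definition drop_time (T : \bar R) : \bar R :=
  ereal_inf [set s%:E | s in
    [set s | (T <= s%:E)%E /\ s <= b /\ c <= sup (f @` window T s) - f s]].

Definition rise_time (T : \bar R) : \bar R :=
  ereal_inf [set s%:E | s in
    [set s | (T <= s%:E)%E /\ s <= b /\ c <= f s - inf (f @` window T s)]].

Definition next_drop (T : \bar R) : \bar R :=
  if (T < b%:E)%E then drop_time T else +oo%E.

Definition next_rise (T : \bar R) : \bar R :=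
  if (T < b%:E)%E then rise_time T else +oo%E.

(* The k such that s lies in [lo k; hi k), if there is one. *)
Definition stage (lo hi : nat -> \bar R) (s : R) : option nat :=
  xget None [set Some k | k in [set k | (lo k <= s%:E < hi k)%E]].

(* Case T_D^c f >= T_U^c f. *)

Fixpoint TU (k : nat) : \bar R :=
  if k is k'.+1 then next_rise (next_drop (TU k')) else rise_time a%:E.

Definition TD (k : nat) : \bar R := next_drop (TU k).

(* T_{D,k-1}, with T_{D,-1} = a *)
Definition TDpred (k : nat) : \bar R := if k is k'.+1 then TD k' else a%:E.

Definition m_at (k : nat) (s : R) : R := inf (f @` window (TDpred k) s).
Definition m_ (k : nat) : R := inf (f @` stretch (TDpred k) (TU k)).
Definition M_at (k : nat) (s : R) : R := sup (f @` window (TU k) s).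
Definition M_ (k : nat) : R := sup (f @` stretch (TU k) (TD k)).

Definition fU_up (s : R) : R :=
  if (s%:E < TU 0)%E then 0 else
  if stage TU TD s is Some k then
    \sum_(0 <= i < k) (M_ i - m_ i - c) + M_at k s - m_ k - c
  else if stage TD (TU \o succn) s is Some k then
    \sum_(0 <= i < k.+1) (M_ i - m_ i - c)
  else 0.

Definition fD_up (s : R) : R :=
  if (s%:E < TU 0)%E then 0 else
  if stage TU TD s is Some k then
    \sum_(0 <= i < k) (M_ i - m_ i.+1 - c)
  else if stage TD (TU \o succn) s is Some k then
    \sum_(0 <= i < k) (M_ i - m_ i.+1 - c) + M_ k - m_at k.+1 s - c
  else 0.

(* Case T_D^c f < T_U^c f. *)

Fixpoint SD (k : nat) : \bar R :=
  if k is k'.+1 then next_drop (next_rise (SD k')) else drop_time a%:E.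

Definition SU (k : nat) : \bar R := next_rise (SD k).

(* S_{U,k-1}, with S_{U,-1} = a *)
Definition SUpred (k : nat) : \bar R := if k is k'.+1 then SU k' else a%:E.

Definition N_at (k : nat) (s : R) : R := sup (f @` window (SUpred k) s).
Definition N_ (k : nat) : R := sup (f @` stretch (SUpred k) (SD k)).
Definition n_at (k : nat) (s : R) : R := inf (f @` window (SD k) s).
Definition n_ (k : nat) : R := inf (f @` stretch (SD k) (SU k)).

Definition fD_down (s : R) : R :=
  if (s%:E < SD 0)%E then 0 else
  if stage SD SU s is Some k then
    \sum_(0 <= i < k) (N_ i - n_ i - c) + N_ k - n_at k s - c
  else if stage SU (SD \o succn) s is Some k then
    \sum_(0 <= i < k.+1) (N_ i - n_ i - c)
  else 0.

Definition fU_down (s : R) : R :=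
  if (s%:E < SD 0)%E then 0 else
  if stage SD SU s is Some k then
    \sum_(0 <= i < k) (N_ i.+1 - n_ i - c)
  else if stage SU (SD \o succn) s is Some k then
    \sum_(0 <= i < k) (N_ i.+1 - n_ i - c) + N_at k.+1 s - n_ k - c
  else 0.

Definition fU (s : R) : R :=
  if (rise_time a%:E <= drop_time a%:E)%E then fU_up s else fU_down s.

Definition fD (s : R) : R :=
  if (rise_time a%:E <= drop_time a%:E)%E then fD_up s else fD_down s.

Definition fic (s : R) : R := fU s - fD s.

End Construction.

(* Main.v *)
Require Import Defs.
From HB Require Import structures.
From mathcomp Require Import all_boot all_order all_algebra.
From mathcomp Require Import all_classical all_reals all_analysis.
From mathcomp Require Import lra.

Set Implicit Arguments.
Unset Strict Implicit.
Unset Printing Implicit Defensive.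

Import Order.TTheory GRing.Theory Num.Theory.
Import numFieldNormedType.Exports.

Local Open Scope classical_set_scope.
Local Open Scope ring_scope.

(** Let [h] be the process f_U - f_D and [V] the process f_U + f_D.

    The construction cuts the interval into finitely many stages; there [f] is
    followed alternately through its running supremum and through its running
    infimum; a stage ends when [f] has come back by [c] from that extremum.
    Putting a sign [dir j] on stage [j] turns every stage into one that follows
    the running supremum [level j] of [signed j = dir j * f], and makes every
    switching time a drop time of [signed j]. In these terms [V] is a sum of
    steps [top i + top i.+1 - c], with [top i] the supremum of [signed i] over
    stage [i] and with [level] in place of [top] in the current stage, and [h]
    is the same sum with each step multiplied by the sign of its stage
    ([fU_fD_climb], [fic_climb]). Both cases of the construction are covered:
    they differ by the sign of stage 0 only.

    The steps are nonnegative ([step_ge0]), hence the increments of [h] are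
    dominated by those of [V] ([climb_increment_le]), and TV(h, [a; s]) is at
    most V(s).

    Conversely, let the increments of [g] be within [c] of those of [f]. Take a
    point [t] of stage [j] with [signed j t] close to [top j], and a point [s']
    of stage [j.+1] with [signed j.+1 s'] close to [level j.+1 s]. From [t] to
    [s'] the function [g] moves in the direction [dir j.+1] by at least the
    corresponding step, up to a small error. Induction on the stages then yields

      V(s) + |g(s) - g(a) - h(s)| <= TV(g, [a; s])

    ([climb_le_total_variation]); the second summand on the left survives the
    induction because a move longer than the step costs exactly its excess.
    Together the two bounds give the theorem: the lower bound is immediate, and
    if TV(g, [a; s]) <= TV(h, [a; s]) the absolute value must vanish. *)

(** * One-sided limits *)

Lemma at_right_interval (R : realType) (x : R) (P : R -> Prop) :
  (\forall y \near x^'+, P y) ->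
  exists2 d, 0 < d & forall y, x < y -> y < x + d -> P y.
Proof.
case=> d /= d0 xP; exists d => // y xy yd; apply: xP => //=.
by rewrite distrC gtr0_norm ?subr_gt0//; lra.
Qed.

Lemma at_left_interval (R : realType) (x : R) (P : R -> Prop) :
  (\forall y \near x^'-, P y) ->
  exists2 d, 0 < d & forall y, x - d < y -> y < x -> P y.
Proof.
case=> d /= d0 xP; exists d => // y xy yd; apply: xP => //=.
by rewrite gtr0_norm ?subr_gt0//; lra.
Qed.

Lemma cadlag_right_close (R : realType) (a b : R) (f : R -> R) (s e : R) :
  cadlag_on a b f -> a <= s -> s < b -> 0 < e ->
  exists2 d, 0 < d & forall y, s < y -> y < s + d -> `|f y - f s| < e.
Proof.
move=> [cf _] as_ sb e0; apply: at_right_interval.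
by have /cvgr_distC_lt := cf s as_ sb; exact.
Qed.

Lemma cadlag_left_close (R : realType) (a b : R) (f : R -> R) (s e : R) :
  cadlag_on a b f -> a < s -> s <= b -> 0 < e ->
  exists2 d, 0 < d & forall x y,
    s - d < x -> x < s -> s - d < y -> y < s -> `|f y - f x| < e.
Proof.
move=> [_ cf] as_ sb e0.
have e20 : 0 < e / 2 by rewrite divr_gt0.
have /cvgr_distC_lt/(_ _ e20) := cf s as_ sb.
move=> /at_left_interval[d d0 close]; exists d => // x y dx xs dy ys.
have := close x dx xs; have := close y dy ys.
move: (lim _) => l; rewrite !ltr_norml => /andP[? ?] /andP[? ?].
by apply/andP; split; lra.
Qed.

(** Near each point the one-sided limits bound [f] on both sides; compactness of
    the interval makes the bound uniform. This gives the real [sup] and [inf] of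
    the construction their usual meaning. *)
Lemma cadlag_bounded (R : realType) (a b : R) (f : R -> R) :
  cadlag_on a b f -> exists M, forall s, a <= s <= b -> `|f s| <= M.
Proof.
move=> cf.
have /compact_near_coveringP/near_covering_withinP := @segment_compact R a b.
move=> /(_ _ (pinfty_nbhs R) (fun M s => `|f s| <= M) _) => locb.
suff : \forall M \near +oo, `[a, b]%classic `<=` (fun s => `|f s| <= M).
  case=> M [_ Mb]; exists (M + 1) => s sab.
  by apply: (Mb (M + 1)); [lra|rewrite /= in_itv].
apply: locb => x.
rewrite /= in_itv/= => /andP[ax xb].
  (* At an endpoint, any bound will do on the side outside the interval. *)
  have [dl dl0 closel] : exists2 d, 0 < d & exists K, forall y,
      x - d < y -> y < x -> a <= y -> `|f y| <= K.
    have [xa|ax'] := leP x a.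
      by exists 1 => //; exists 0 => y _ yx ay; lra.
    have [d d0 close] := cadlag_left_close cf ax' xb ltr01.
    exists d => //; exists (`|f (x - d / 2)| + 1) => y dy yx _.
    have := close (x - d / 2) y; rewrite dy yx.
    have -> : x - d < x - d / 2 by lra.
    have -> : x - d / 2 < x by lra.
    move=> /(_ isT isT isT isT) lt1; rewrite -[f y](subrK (f (x - d / 2))).
    by rewrite (le_trans (ler_normD _ _))// addrC lerD2l ltW.
  have [dr dr0 closer] : exists2 d, 0 < d & exists K, forall y,
      x < y -> y < x + d -> y <= b -> `|f y| <= K.
    have [bx|xb'] := leP b x.
      by exists 1 => //; exists 0 => y xy _ yb; lra.
    have [d d0 close] := cadlag_right_close cf ax xb' ltr01.
    exists d => //; exists (`|f x| + 1) => y xy yd _.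
    have lt1 := close y xy yd; rewrite -[f y](subrK (f x)).
    by rewrite (le_trans (ler_normD _ _))// addrC lerD2l ltW.
  case: closel => Kl closel; case: closer => Kr closer.
  near=> y M => /=; rewrite in_itv/= => /andP[ay yb].
  have yl : x - dl < y by near: y; apply: lt_nbhsr; lra.
  have yr : y < x + dr by near: y; apply: lt_nbhsl; lra.
  have [yx|xy|->] := ltgtP y x.
  + apply: (le_trans (closel y yl yx ay)).
    by near: M; apply: nbhs_pinfty_ge; exact: num_real.
  + apply: (le_trans (closer y xy yr yb)).
    by near: M; apply: nbhs_pinfty_ge; exact: num_real.
  + by near: M; apply: nbhs_pinfty_ge; exact: num_real.
Unshelve. all: by end_near. Qed.

(** * Running suprema and hitting times *)

Section Levels.
Variables (R : realType) (a b : R) (F : R -> R).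
Hypothesis cF : cadlag_on a b F.

Definition running_sup (T : \bar R) (s : R) : R := sup (F @` window T s).

Definition stretch_sup (T T' : \bar R) : R := sup (F @` stretch a b T T').

Lemma running_sup_ge (t u s : R) :
  a <= t -> t <= u -> u <= s -> s <= b -> F u <= running_sup t%:E s.
Proof.
move=> at_ tu us sb; apply: ub_le_sup; last first.
  by exists u => //; split; rewrite ?lee_fin.
have [M FM] := cadlag_bounded cF.
exists M => _ [v [+ vs] <-]; rewrite lee_fin => tv.
by rewrite (le_trans (ler_norm _))// FM// (le_trans at_ tv) (le_trans vs sb).
Qed.

Lemma running_sup_le (t s M : R) : t <= s ->
  (forall u, t <= u -> u <= s -> F u <= M) -> running_sup t%:E s <= M.
Proof.
move=> ts FM; apply: ge_sup.
  by exists (F s), s => //; split; rewrite ?lee_fin.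
by move=> _ [v [+ vs] <-]; rewrite lee_fin => tv; exact: FM.
Qed.

Lemma running_sup_approx (t s e : R) : a <= t -> t <= s -> s <= b -> 0 < e ->
  exists u, [/\ t <= u, u <= s & running_sup t%:E s - e < F u].
Proof.
move=> at_ ts sb e0; apply: contrapT => noapprox.
suff : running_sup t%:E s <= running_sup t%:E s - e by lra.
apply: running_sup_le => // u tu us; rewrite leNgt; apply/negP => lt.
by apply: noapprox; exists u.
Qed.

Lemma stretch_sup_ge (t u : R) (T' : \bar R) :
  a <= t -> t <= u -> u <= b -> (u%:E < T')%E -> F u <= stretch_sup t%:E T'.
Proof.
move=> at_ tu ub uT'; apply: ub_le_sup; last first.
  exists u => //; split; first by rewrite (le_trans at_ tu).
  by rewrite lee_fin tu.
have [M FM] := cadlag_bounded cF.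
by exists M => _ [v [vab _] <-]; rewrite (le_trans (ler_norm _))// FM.
Qed.

Lemma stretch_sup_approx (t e : R) (T' : \bar R) :
  a <= t -> t <= b -> (t%:E < T')%E -> 0 < e ->
  exists u, [/\ t <= u, u <= b, (u%:E < T')%E & stretch_sup t%:E T' - e < F u].
Proof.
move=> at_ tb tT' e0; apply: contrapT => noapprox.
suff : stretch_sup t%:E T' <= stretch_sup t%:E T' - e by lra.
apply: ge_sup; first by exists (F t), t => //; split; rewrite ?at_ ?tb ?lexx.
move=> _ [u [/andP[au ub] /andP[+ uT']] <-]; rewrite lee_fin => tu.
by rewrite leNgt; apply/negP => lt; apply: noapprox; exists u.
Qed.

Lemma running_sup_le_stretch_sup (t s : R) (T' : \bar R) :
  a <= t -> t <= s -> s <= b -> (s%:E < T')%E ->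
  running_sup t%:E s <= stretch_sup t%:E T'.
Proof.
move=> at_ ts sb sT'; apply: running_sup_le => // u tu us.
apply: stretch_sup_ge => //; first exact: le_trans us sb.
by apply: le_lt_trans sT'; rewrite lee_fin.
Qed.

Lemma running_sup_homo (t u s : R) :
  a <= t -> t <= u -> u <= s -> s <= b ->
  running_sup t%:E u <= running_sup t%:E s.
Proof.
move=> at_ tu us sb; apply: running_sup_le => // v tv vu.
by apply: running_sup_ge => //; exact: le_trans vu us.
Qed.

Variable c : R.
Hypothesis c0 : 0 < c.

Lemma drop_time_ge (T : \bar R) : (T <= drop_time b c F T)%E.
Proof. by apply: le_ereal_inf_tmp => _ [s [Ts _] <-]. Qed.

(** By right continuity the drop by [c] has occurred at the hitting time itself,
    so the infimum defining it is attained. *)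
Lemma drop_time_attained (t r : R) : a <= t -> drop_time b c F t%:E = r%:E ->
  [/\ t <= r, r <= b & c <= running_sup t%:E r - F r].
Proof.
move=> at_ dr.
have tr : t <= r by rewrite -lee_fin -dr drop_time_ge.
have hit (d : R) : 0 < d -> exists s,
    [/\ r <= s, s < r + d, s <= b & c <= running_sup t%:E s - F s].
  move=> d0; have /ereal_inf_lt[_ [s [ts [sb cs]] <-]] :
      (drop_time b c F t%:E < (r + d)%:E)%E by rewrite dr lte_fin; lra.
  rewrite lte_fin => sd; exists s; split => //.
  by rewrite -lee_fin -dr; apply: ereal_inf_lbound; exists s.
have rb : r <= b.
  by have [s [rs _ sb _]] := hit 1 ltr01; exact: le_trans rs sb.
split => //; rewrite leNgt; apply/negP => nodrop.
pose e := (c - (running_sup t%:E r - F r)) / 2.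
have e0 : 0 < e by rewrite /e; lra.
have later (s : R) : r <= s -> s <= b -> c <= running_sup t%:E s - F s ->
    r < s.
  rewrite le_eqVlt => /orP[/eqP <- _ |//]; lra.
have rltb : r < b.
  have [s [rs _ sb cs]] := hit 1 ltr01.
  exact: lt_le_trans (later s rs sb cs) sb.
have [d d0 close] := cadlag_right_close cF (le_trans at_ tr) rltb e0.
have [s [rs sd sb cs]] := hit d d0.
have r_s := later s rs sb cs.
have near_r (v : R) : r < v -> v <= s -> F r - e < F v < F r + e.
  by move=> rv vs; have := close v rv (le_lt_trans vs sd); rewrite ltr_distl.
suff : running_sup t%:E s <= running_sup t%:E r + e.
  by have /andP[+ _] := near_r s r_s (lexx s); rewrite /e; lra.
apply: running_sup_le => [|v tv vs]; first exact: le_trans tr rs.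
have [vr|rv] := leP v r.
  by have := running_sup_ge at_ tv vr rb; lra.
have /andP[_] := near_r v rv vs.
by have := running_sup_ge at_ tr (lexx r) rb; lra.
Qed.

(** The running supremum starts at [F t], so no drop is possible at time [t]. *)
Lemma drop_time_gt (t : R) : a <= t -> (t%:E < drop_time b c F t%:E)%E.
Proof.
move=> at_; rewrite lt_neqAle drop_time_ge andbT; apply/eqP => /esym dt.
have [_ tb cdrop] := drop_time_attained at_ dt.
suff : running_sup t%:E t <= F t by have := c0; lra.
apply: running_sup_le => // u tu ut.
by rewrite (_ : u = t)//; apply/eqP; rewrite eq_le ut.
Qed.

(** At the hitting time [r] itself [F r] is too low to be the running supremum,
    which is therefore already reached before [r]. *)
Lemma drop_time_stretch_sup (t r : R) : a <= t ->
  drop_time b c F t%:E = r%:E -> c <= stretch_sup t%:E r%:E - F r.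
Proof.
move=> at_ dr; have [tr rb cdrop] := drop_time_attained at_ dr.
rewrite leNgt; apply/negP => small.
suff : running_sup t%:E r <= Num.max (F r) (stretch_sup t%:E r%:E).
  by rewrite le_max => /orP[]; have := c0; lra.
apply: running_sup_le => // u tu; rewrite le_max le_eqVlt => /orP[/eqP ->|ur].
  by rewrite lexx.
apply/orP; right; apply: stretch_sup_ge => //; exact: le_trans (ltW ur) rb.
Qed.

End Levels.

(** * Alternating stages *)

Section Stages.
Variables (R : realType) (a b c : R) (f : R -> R) (up : bool).

(** The case of the construction in which a rise comes first has [up = true]:
    stage 0 follows the infimum, hence has sign -1, and odd stages follow the
    supremum. *)
Definition dir (j : nat) : R := if odd j == up then 1 else -1.

Definition signed (j : nat) (s : R) : R := dir j * f s.

Fixpoint tau (j : nat) : \bar R :=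
  if j is i.+1 then next_drop b c (signed i) (tau i) else a%:E.

Definition in_stage (j : nat) (s : R) : Prop :=
  a <= s <= b /\ (tau j <= s%:E < tau j.+1)%E.

Definition level (j : nat) (s : R) : R := running_sup (signed j) (tau j) s.

Definition top (j : nat) : R := stretch_sup a b (signed j) (tau j) (tau j.+1).

(** The rise of [signed j.+1] over stage [j.+1], counted from the extremum of
    stage [j], less the tolerance [c]. *)
Definition gap (j : nat) : R := top j + top j.+1 - c.

(** The weights [w] select the process: the constant 1 gives f_U + f_D, [dir]
    gives f_U - f_D, and the indicators of the two parities give f_U and f_D.
    Stage 0 contributes nothing: it only sets the level from which the first
    step is measured. *)
Definition climb (w : nat -> R) (j : nat) (s : R) : R :=
  if j is i.+1 then
    \sum_(0 <= k < i) w k.+1 * gap k + w i.+1 * (top i + level i.+1 s - c)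
  else 0.

Lemma dirS (j : nat) : dir j.+1 = - dir j.
Proof. by rewrite /dir /=; case: (odd j); case: up => /=; rewrite ?opprK. Qed.

Lemma dir_cases (j : nat) : dir j = 1 \/ dir j = -1.
Proof. by rewrite /dir; case: ifP; [left|right]. Qed.

Lemma normr_dir (j : nat) : `|dir j| = 1.
Proof. by have [->|->] := dir_cases j; rewrite ?normrN normr1. Qed.

Lemma signedS (j : nat) (s : R) : signed j.+1 s = - signed j s.
Proof. by rewrite /signed dirS mulNr. Qed.

Hypotheses (c0 : 0 < c) (cf : cadlag_on a b f).

Lemma cadlag_signed (j : nat) : cadlag_on a b (signed j).
Proof.
have [fr fl] := cf; split=> s as_ sb.
  by apply: cvgM; [exact: cvg_cst|exact: fr].
by apply: is_cvgM; [exact: is_cvg_cst|exact: fl].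
Qed.

Lemma tauS_ge (j : nat) : (tau j <= tau j.+1)%E.
Proof. by rewrite /= /next_drop; case: ifP; rewrite ?leey// drop_time_ge. Qed.

Lemma tau_homo (i j : nat) : (i <= j)%N -> (tau i <= tau j)%E.
Proof.
move=> /subnK <-; elim: (j - i)%N => [|n ih]; first by rewrite add0n.
by rewrite addSn; exact: le_trans ih (tauS_ge _).
Qed.

Lemma tau_ge (j : nat) : (a%:E <= tau j)%E.
Proof. exact: (@tau_homo 0). Qed.

Lemma tau_fin (j : nat) (s : R) : (tau j <= s%:E)%E ->
  exists t, [/\ tau j = t%:E, a <= t & t <= s].
Proof.
have := tau_ge j; case: (tau j) => [t||]; rewrite ?leye_eq//.
by rewrite !lee_fin => at_ ts; exists t.
Qed.

Lemma tauS_gt (j : nat) : (tau j <= b%:E)%E -> (tau j < tau j.+1)%E.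
Proof.
move=> /tau_fin[t [tE at_ tb]] /=; rewrite /next_drop tE lte_fin.
case: ifP => _; last exact: ltry.
exact: (drop_time_gt (cadlag_signed j) c0 at_).
Qed.

Lemma in_stage_tau (j : nat) (s : R) : in_stage j s ->
  exists t, [/\ tau j = t%:E, a <= t, t <= s & s <= b].
Proof.
move=> [/andP[_ sb] /andP[js _]].
by have [t [tE at_ ts]] := tau_fin js; exists t.
Qed.

Lemma in_stage_start (j : nat) (r : R) :
  tau j = r%:E -> r <= b -> in_stage j r.
Proof.
move=> jr rb; have := tau_ge j; rewrite jr lee_fin => ar; split.
  by rewrite ar rb.
by have := @tauS_gt j; rewrite jr lexx lee_fin; exact.
Qed.

Lemma in_stage_le (i j : nat) (u s : R) :
  in_stage i u -> in_stage j s -> u <= s -> (i <= j)%N.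
Proof.
move=> [_ /andP[iu _]] [_ /andP[_ sj]] us; rewrite leqNgt; apply/negP => ji.
have := lt_le_trans sj (le_trans (tau_homo ji) iu).
by rewrite lte_fin ltNge us.
Qed.

Lemma in_stage_inj (i j : nat) (s : R) : in_stage i s -> in_stage j s -> i = j.
Proof.
by move=> si sj; apply/eqP; rewrite eqn_leq !(in_stage_le _ _ (lexx s)).
Qed.

Lemma tauS_fin (j : nat) (r : R) : tau j.+1 = r%:E -> exists t,
  [/\ tau j = t%:E, a <= t, t < r, r <= b & c <= top j - signed j r].
Proof.
move=> jr.
have [t [tE at_ _]] : exists t, [/\ tau j = t%:E, a <= t & t <= r].
  by apply: tau_fin; rewrite -jr tauS_ge.
have dr : drop_time b c (signed j) t%:E = r%:E.
  by move: jr; rewrite /= /next_drop tE; case: ifP.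
have [tr rb _] := drop_time_attained (cadlag_signed j) at_ dr.
exists t; split => //.
  have := drop_time_gt (cadlag_signed j) c0 at_.
  by rewrite dr lte_fin.
rewrite /top jr tE.
exact: (drop_time_stretch_sup (cadlag_signed j) c0 at_ dr).
Qed.

Lemma top_approx (j : nat) (s e : R) : in_stage j s -> 0 < e ->
  exists2 u, in_stage j u & top j - e < signed j u.
Proof.
move=> sj e0; have [t [tE at_ ts sb]] := in_stage_tau sj.
case: sj => _ /andP[js sj'].
have tj : (t%:E < tau j.+1)%E by rewrite -tE; exact: le_lt_trans js sj'.
have [u [tu ub uj ue]] :=
  stretch_sup_approx (signed j) at_ (le_trans ts sb) tj e0.
rewrite -tE in ue.
exists u => //.
by split; rewrite ?ub ?(le_trans at_ tu)// tE lee_fin tu.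
Qed.

Lemma level_ge (j : nat) (s : R) : in_stage j s -> signed j s <= level j s.
Proof.
move=> sj; have [t [tE at_ ts sb]] := in_stage_tau sj; rewrite /level tE.
exact: (running_sup_ge (cadlag_signed j)).
Qed.

Lemma level_approx (j : nat) (s e : R) : in_stage j s -> 0 < e ->
  exists u, [/\ in_stage j u, u <= s & level j s - e < signed j u].
Proof.
move=> sj e0; have [t [tE at_ ts sb]] := in_stage_tau sj.
have [u [tu us ue]] := @running_sup_approx _ a b (signed j) t s e at_ ts sb e0.
exists u; rewrite /level tE; split => //; split.
  by rewrite (le_trans at_ tu) (le_trans us sb).
rewrite tE lee_fin tu; case: sj => _ /andP[_]; exact: le_lt_trans.
Qed.

Lemma level_homo (j : nat) (u s : R) :
  in_stage j u -> in_stage j s -> u <= s -> level j u <= level j s.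
Proof.
move=> uj sj us; have [t [tE at_ tu _]] := in_stage_tau uj.
have [_ [_ _ _ sb]] := in_stage_tau sj; rewrite /level tE.
exact: (running_sup_homo (cadlag_signed j)).
Qed.

Lemma level_le_top (j : nat) (s : R) : in_stage j s -> level j s <= top j.
Proof.
move=> sj; have [t [tE at_ ts sb]] := in_stage_tau sj.
case: sj => _ /andP[_ sj]; rewrite /level /top tE.
exact: (running_sup_le_stretch_sup (cadlag_signed j)).
Qed.

(** At the start [r] of stage [j.+1] the function [signed j] has dropped by [c]
    below [top j], and [signed j.+1 r = - signed j r]. *)
Lemma step_ge0 (j : nat) (s : R) :
  in_stage j.+1 s -> 0 <= top j + level j.+1 s - c.
Proof.
move=> sj; have [r [rE ar rs sb]] := in_stage_tau sj.
have [t [tE at_ tr rb ctop]] := tauS_fin rE.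
have rj := in_stage_start rE rb.
have := level_homo rj sj rs; have := level_ge rj; rewrite signedS; lra.
Qed.

Lemma gap_ge0 (j : nat) (s : R) : in_stage j.+1 s -> 0 <= gap j.
Proof.
by move=> sj; have := step_ge0 sj; have := level_le_top sj; rewrite /gap; lra.
Qed.

Lemma in_stage_pred (i j : nat) (s : R) : in_stage j s -> (i <= j)%N ->
  exists2 t, in_stage i t & t <= s.
Proof.
move=> sj ij; have [t' [tE at_ ts sb]] := in_stage_tau sj.
have [t [iE ai tt]] : exists t, [/\ tau i = t%:E, a <= t & t <= t'].
  by apply: tau_fin; rewrite -tE tau_homo.
exists t; last exact: le_trans tt ts.
by apply: in_stage_start => //; apply: le_trans sb; exact: le_trans tt ts.
Qed.

(** Between two consecutive times [f] oscillates by at least [c]; if the times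
    accumulated, this would contradict the left limit at their supremum. *)
Lemma in_stage_ex (s : R) : a <= s <= b -> exists j, in_stage j s.
Proof.
move=> /andP[as_ sb]; apply: contrapT => nostage.
have tau_le (j : nat) : (tau j <= s%:E)%E.
  elim: j => [|j ih]; first by rewrite lee_fin.
  rewrite leNgt; apply/negP => sj; apply: nostage; exists j; split.
    by rewrite as_ sb.
  by rewrite ih sj.
pose r j := fine (tau j).
have rE j : tau j = (r j)%:E.
  by have [t [tE _ _]] := tau_fin (tau_le j); rewrite /r tE.
have rs j : r j <= s by rewrite -lee_fin -rE.
have rS j : r j < r j.+1.
  by have [t []] := tauS_fin (rE j.+1); rewrite rE => -[<-].
pose x := sup (range r).
have rx j : r j < x.
  apply: lt_le_trans (rS j) _; apply: ub_le_sup; last by exists j.+1.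
  by exists s => _ [k _ <-].
have xs : x <= s by apply: ge_sup; [exists (r 0%N), 0%N|move=> _ [k _ <-]].
have ax : a < x := rx 0%N.
have c20 : 0 < c / 2 by rewrite divr_gt0.
have [d d0 close] := cadlag_left_close cf ax (le_trans xs sb) c20.
have [j jx] : exists j, x - d < r j.
  apply: contrapT => nolate; suff : x <= x - d by lra.
  apply: ge_sup; first by exists (r 0%N), 0%N.
  move=> _ [k _ <-]; rewrite leNgt; apply/negP => late; apply: nolate.
  by exists k.
have jin := in_stage_start (rE j) (le_trans (rs j) sb).
have [u uj utop] := top_approx jin c20.
have [_ [_ _ _ _ ctop]] := tauS_fin (rE j.+1).
case: uj => _; rewrite !rE lee_fin lte_fin => /andP[ju uj].
have := close u (r j.+1) (lt_le_trans jx ju) (lt_trans uj (rx _))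
  (lt_trans jx (rS j)) (rx _).
rewrite -[`|_|]mul1r -[X in X * _](normr_dir j) -normrM mulrBr -!/(signed j _).
rewrite ltr_norml => /andP[+ _].
by lra.
Qed.

End Stages.

(** * The processes as sums over stages *)

Lemma infE (R : realType) (f : R -> R) (A : set R) :
  inf (f @` A) = - sup ((\- f) @` A).
Proof. by rewrite /inf image_comp. Qed.

Lemma rise_timeE (R : realType) (b c : R) (f : R -> R) (T : \bar R) :
  rise_time b c f T = drop_time b c (\- f) T.
Proof.
rewrite /rise_time /drop_time; congr (ereal_inf (_ @` _)).
by apply/funext => s /=; rewrite infE !opprK [f s + _]addrC.
Qed.

Lemma next_riseE (R : realType) (b c : R) (f : R -> R) (T : \bar R) :
  next_rise b c f T = next_drop b c (\- f) T.
Proof. by rewrite /next_rise /next_drop rise_timeE. Qed.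

Lemma stage_some (R : realType) (lo hi : nat -> \bar R) (s : R) (k : nat) :
  (lo k <= s%:E < hi k)%E ->
  (forall i, (lo i <= s%:E < hi i)%E -> i = k) -> stage lo hi s = Some k.
Proof.
move=> ks uniq_k; apply: xget_unique; first by exists k.
by move=> _ [i /= /uniq_k -> <-].
Qed.

Lemma stage_none (R : realType) (lo hi : nat -> \bar R) (s : R) :
  (forall i, ~ (lo i <= s%:E < hi i)%E) -> stage lo hi s = None.
Proof.
by move=> nos; apply: xgetPN => y [i /nos].
Qed.

Section Identification.
Variables (R : realType) (a b c : R) (f : R -> R).

Lemma signed_pos (up : bool) (j : nat) : odd j = up -> signed f up j = f.
Proof. by move=> ju; apply/funext => s; rewrite /signed /dir ju eqxx mul1r. Qed.

Lemma signed_neg (up : bool) (j : nat) : odd j = ~~ up -> signed f up j = \- f.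
Proof.
move=> ju; apply/funext => s; rewrite /signed /dir ju.
by case: up {ju} => /=; rewrite mulN1r.
Qed.

Variable up : bool.

Notation tau := (tau a b c f up).
Notation in_stage := (in_stage a b c f up).
Notation gap := (gap a b c f up).
Notation top := (top a b c f up).
Notation level := (level a b c f up).
Notation climb := (climb a b c f up).

Lemma in_stageP (j : nat) (s : R) : a <= s <= b ->
  (tau j <= s%:E < tau j.+1)%E -> in_stage j s.
Proof. by []. Qed.

Lemma stage_odd (k : nat) (s : R) : in_stage k.*2.+1 s ->
  stage (fun k => tau k.*2.+1) (fun k => tau k.*2.+2) s = Some k.
Proof.
move=> sk; have [sab ks] := sk; apply: stage_some => // i si.
have := in_stage_inj (in_stageP sab si) sk.
by move=> [/(congr1 half)]; rewrite !doubleK.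
Qed.

Lemma stage_odd_none (k : nat) (s : R) : in_stage k.*2 s ->
  stage (fun k => tau k.*2.+1) (fun k => tau k.*2.+2) s = None.
Proof.
move=> sk; have [sab ks] := sk; apply: stage_none => i si.
have /(congr1 odd) := in_stage_inj (in_stageP sab si) sk.
by rewrite /= !odd_double.
Qed.

Lemma stage_even (k : nat) (s : R) : in_stage k.*2.+2 s ->
  stage (fun k => tau k.*2.+2) (fun k => tau k.+1.*2.+1) s = Some k.
Proof.
move=> sk; have [sab ks] := sk; apply: stage_some => // i si.
have := in_stage_inj (in_stageP sab si) sk.
by move=> [/(congr1 half)]; rewrite !doubleK.
Qed.

Lemma climbD (v w : nat -> R) (u : R) (j : nat) (s : R) :
  climb v j s + u * climb w j s = climb (fun i => v i + u * w i) j s.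
Proof.
case: j => [|j] /=; first by rewrite mulr0 addr0.
rewrite [u * _]mulrDr mulr_sumr addrACA -big_split/=; congr (_ + _).
  by apply: eq_bigr => i _; lra.
by lra.
Qed.

Lemma climb_odd (p q : R) (k : nat) (s : R) :
  climb (fun i => if odd i then p else q) k.*2.+1 s =
  p * (\sum_(0 <= i < k) gap i.*2) + q * (\sum_(0 <= i < k) gap i.*2.+1)
  + p * (top k.*2 + level k.*2.+1 s - c).
Proof.
rewrite /climb /= odd_double; congr (_ + _).
elim: k => [|k ih]; first by rewrite !big_nil !mulr0 addr0.
rewrite doubleS !big_nat_recr//= ih odd_double /=; lra.
Qed.

Lemma climb_even (p q : R) (k : nat) (s : R) :
  climb (fun i => if odd i then p else q) k.*2.+2 s =
  p * (\sum_(0 <= i < k.+1) gap i.*2) + q * (\sum_(0 <= i < k) gap i.*2.+1)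
  + q * (top k.*2.+1 + level k.*2.+2 s - c).
Proof.
have := climb_odd p q k s; rewrite /climb /= !big_nat_recr//= odd_double /=.
lra.
Qed.

Lemma stage_index_cases (j : nat) :
  [\/ j = 0%N, exists k, j = k.*2.+1 | exists k, j = k.*2.+2].
Proof.
case: j => [|j]; first by constructor 1.
have := odd_double_half j; case: (odd j) => /= <-.
  by constructor 3; exists j./2; rewrite add1n.
by constructor 2; exists j./2.
Qed.

Lemma before_tau1 (j : nat) (s : R) : in_stage j s ->
  (s%:E < tau 1)%E = (j == 0)%N.
Proof.
move=> sj; have [sab /andP[js sj1]] := sj; apply/idP/eqP => [s1|j0].
  apply: in_stage_inj sj _; split => //=.
  by rewrite lee_fin; have /andP[-> _] := sab.
by rewrite j0 in sj1.
Qed.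

End Identification.

Section UpCase.
Variables (R : realType) (a b c : R) (f : R -> R).
Hypothesis ab : a < b.

Notation tau := (tau a b c f true).
Notation in_stage := (in_stage a b c f true).
Notation climb := (climb a b c f true).

Lemma tau_up (k : nat) :
  tau k.*2 = TDpred a b c f k /\ tau k.*2.+1 = TU a b c f k.
Proof.
elim: k => [|k [_ ih]].
  split => //=; rewrite /next_drop lte_fin ab rise_timeE.
  by rewrite (@signed_neg _ _ true).
have evn : tau k.+1.*2 = TD a b c f k.
  by rewrite doubleS [LHS]/= -/(tau k.*2.+1) ih signed_pos//= odd_double.
split; first exact: evn.
rewrite -[LHS]/(next_drop b c _ (tau k.+1.*2)) evn /= next_riseE.
by rewrite (@signed_neg _ _ true)//= odd_double.
Qed.

Lemma TU_tau : TU a b c f = fun k => tau k.*2.+1.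
Proof. by apply/funext => k; have [] := tau_up k. Qed.

Lemma TD_tau : TD a b c f = fun k => tau k.*2.+2.
Proof. by apply/funext => k; have [-> _] := tau_up k.+1. Qed.

Lemma m_top (k : nat) : m_ a b c f k = - top a b c f true k.*2.
Proof.
rewrite /m_ /top /stretch_sup; have [-> ->] := tau_up k.
by rewrite infE signed_neg//= odd_double.
Qed.

Lemma M_top (k : nat) : M_ a b c f k = top a b c f true k.*2.+1.
Proof.
rewrite /M_ /top /stretch_sup TU_tau TD_tau signed_pos//=.
by rewrite odd_double.
Qed.

Lemma m_at_level (k : nat) (s : R) :
  m_at a b c f k s = - level a b c f true k.*2 s.
Proof.
rewrite /m_at /level /running_sup; have [-> _] := tau_up k.
by rewrite infE signed_neg//= odd_double.
Qed.

Lemma M_at_level (k : nat) (s : R) :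
  M_at a b c f k s = level a b c f true k.*2.+1 s.
Proof.
by rewrite /M_at /level /running_sup TU_tau signed_pos//= odd_double.
Qed.

Lemma gap_even_up (k : nat) :
  M_ a b c f k - m_ a b c f k - c = gap a b c f true k.*2.
Proof. by rewrite M_top m_top /gap; lra. Qed.

Lemma gap_odd_up (k : nat) :
  M_ a b c f k - m_ a b c f k.+1 - c = gap a b c f true k.*2.+1.
Proof. by rewrite M_top m_top /gap doubleS; lra. Qed.

Lemma fU_up_climb (j : nat) (s : R) : in_stage j s ->
  fU_up a b c f s = climb (fun i => if odd i then 1 else 0) j s.
Proof.
move=> sj; rewrite /fU_up TU_tau TD_tau (before_tau1 sj).
have [j0|[k jk]|[k jk]] := stage_index_cases j; subst j => //.
- rewrite (stage_odd sj) climb_odd M_at_level m_top.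
  under eq_bigr do rewrite gap_even_up.
  by rewrite mul0r mul1r /=; lra.
- rewrite (@stage_odd_none _ _ _ _ _ _ k.+1)// (stage_even sj) climb_even.
  under eq_bigr do rewrite gap_even_up.
  by rewrite !mul0r mul1r /=; lra.
Qed.

Lemma fD_up_climb (j : nat) (s : R) : in_stage j s ->
  fD_up a b c f s = climb (fun i => if odd i then 0 else 1) j s.
Proof.
move=> sj; rewrite /fD_up TU_tau TD_tau (before_tau1 sj).
have [j0|[k jk]|[k jk]] := stage_index_cases j; subst j => //.
- rewrite (stage_odd sj) climb_odd.
  under eq_bigr do rewrite gap_odd_up.
  by rewrite !mul0r mul1r /=; lra.
- rewrite (@stage_odd_none _ _ _ _ _ _ k.+1)// (stage_even sj) climb_even.
  under eq_bigr do rewrite gap_odd_up.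
  by rewrite mul0r !mul1r M_top m_at_level doubleS /=; lra.
Qed.

End UpCase.

Section DownCase.
Variables (R : realType) (a b c : R) (f : R -> R).
Hypothesis ab : a < b.

Notation tau := (tau a b c f false).
Notation in_stage := (in_stage a b c f false).
Notation climb := (climb a b c f false).

Lemma tau_down (k : nat) :
  tau k.*2 = SUpred a b c f k /\ tau k.*2.+1 = SD a b c f k.
Proof.
elim: k => [|k [_ ih]].
  split => //=; rewrite /next_drop lte_fin ab.
  by rewrite (@signed_pos _ _ false).
have evn : tau k.+1.*2 = SU a b c f k.
  rewrite doubleS [LHS]/= -/(tau k.*2.+1) ih /SU next_riseE.
  by rewrite (@signed_neg _ _ false)//= odd_double.
split; first exact: evn.
rewrite -[LHS]/(next_drop b c _ (tau k.+1.*2)) evn /=.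
by rewrite (@signed_pos _ _ false)//= odd_double.
Qed.

Lemma SD_tau : SD a b c f = fun k => tau k.*2.+1.
Proof. by apply/funext => k; have [] := tau_down k. Qed.

Lemma SU_tau : SU a b c f = fun k => tau k.*2.+2.
Proof. by apply/funext => k; have [-> _] := tau_down k.+1. Qed.

Lemma N_top (k : nat) : N_ a b c f k = top a b c f false k.*2.
Proof.
rewrite /N_ /top /stretch_sup; have [-> ->] := tau_down k.
by rewrite signed_pos//= odd_double.
Qed.

Lemma n_top (k : nat) : n_ a b c f k = - top a b c f false k.*2.+1.
Proof.
rewrite /n_ /top /stretch_sup SD_tau SU_tau infE signed_neg//=.
by rewrite odd_double.
Qed.

Lemma N_at_level (k : nat) (s : R) :
  N_at a b c f k s = level a b c f false k.*2 s.
Proof.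
rewrite /N_at /level /running_sup; have [-> _] := tau_down k.
by rewrite signed_pos//= odd_double.
Qed.

Lemma n_at_level (k : nat) (s : R) :
  n_at a b c f k s = - level a b c f false k.*2.+1 s.
Proof.
by rewrite /n_at /level /running_sup SD_tau infE signed_neg//= odd_double.
Qed.

Lemma gap_even_down (k : nat) :
  N_ a b c f k - n_ a b c f k - c = gap a b c f false k.*2.
Proof. by rewrite N_top n_top /gap; lra. Qed.

Lemma gap_odd_down (k : nat) :
  N_ a b c f k.+1 - n_ a b c f k - c = gap a b c f false k.*2.+1.
Proof. by rewrite N_top n_top /gap doubleS; lra. Qed.

Lemma fD_down_climb (j : nat) (s : R) : in_stage j s ->
  fD_down a b c f s = climb (fun i => if odd i then 1 else 0) j s.
Proof.
move=> sj; rewrite /fD_down SU_tau SD_tau (before_tau1 sj).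
have [j0|[k jk]|[k jk]] := stage_index_cases j; subst j => //.
- rewrite (stage_odd sj) climb_odd n_at_level N_top.
  under eq_bigr do rewrite gap_even_down.
  by rewrite mul0r !mul1r /=; lra.
- rewrite (@stage_odd_none _ _ _ _ _ _ k.+1)// (stage_even sj) climb_even.
  under eq_bigr do rewrite gap_even_down.
  by rewrite !mul0r mul1r /=; lra.
Qed.

Lemma fU_down_climb (j : nat) (s : R) : in_stage j s ->
  fU_down a b c f s = climb (fun i => if odd i then 0 else 1) j s.
Proof.
move=> sj; rewrite /fU_down SU_tau SD_tau (before_tau1 sj).
have [j0|[k jk]|[k jk]] := stage_index_cases j; subst j => //.
- rewrite (stage_odd sj) climb_odd.
  under eq_bigr do rewrite gap_odd_down.
  by rewrite !mul0r mul1r /=; lra.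
- rewrite (@stage_odd_none _ _ _ _ _ _ k.+1)// (stage_even sj) climb_even.
  under eq_bigr do rewrite gap_odd_down.
  by rewrite mul0r !mul1r n_top N_at_level doubleS /=; lra.
Qed.

End DownCase.

Section Combination.
Variables (R : realType) (a b c : R) (f : R -> R).
Hypothesis ab : a < b.

Definition starts_up : bool :=
  (rise_time b c f a%:E <= drop_time b c f a%:E)%E.

Notation in_stage := (in_stage a b c f starts_up).

Lemma fU_fD_climb (j : nat) (s : R) : in_stage j s ->
  fU a b c f s + fD a b c f s = climb a b c f starts_up (fun=> 1) j s.
Proof.
rewrite /fU /fD -/starts_up => sj.
rewrite -[fD_up _ _ _ _ _]mul1r -[fD_down _ _ _ _ _]mul1r.
have -> : (fun=> 1) = (fun i => (if odd i then 1 else 0)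
    + 1 * (if odd i then 0 else 1)) :> (nat -> R).
  by apply/funext => i; case: (odd i) => /=; lra.
move: sj; rewrite -climbD; case: ifP => e sj.
  by rewrite (fU_up_climb ab sj) (fD_up_climb ab sj).
by rewrite (fU_down_climb ab sj) (fD_down_climb ab sj) !mul1r addrC.
Qed.

Lemma fic_climb (j : nat) (s : R) : in_stage j s ->
  fic a b c f s = climb a b c f starts_up (dir R starts_up) j s.
Proof.
rewrite /fic /fU /fD -/starts_up /dir; case: starts_up => sj.
  rewrite (fU_up_climb ab sj) (fD_up_climb ab sj).
  rewrite -[- climb _ _ _ _ _ _ _ _]mulN1r climbD.
  by congr (climb _ _ _ _ _ _ _ _); apply/funext => i;
    case: (odd i) => /=; lra.
rewrite (fU_down_climb ab sj) (fD_down_climb ab sj).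
rewrite -[- climb _ _ _ _ _ _ _ _]mulN1r climbD.
by congr (climb _ _ _ _ _ _ _ _); apply/funext => i;
  case: (odd i) => /=; lra.
Qed.

End Combination.

(** * Total variation of the difference process *)

Lemma variation_cons (R : realType) (x y b : R) (h : R -> R) (l : seq R) :
  variation x b h (y :: l) = `|h y - h x| + variation y b h l.
Proof. by rewrite /variation /= big_nat_recl. Qed.

(** The increments of [V] over a partition telescope. *)
Lemma total_variation_le_increment (R : realType) (a s : R) (h V : R -> R) :
  (forall x y, a <= x -> x <= y -> y <= s -> `|h y - h x| <= V y - V x) ->
  (total_variation a s h <= (V s - V a)%:E)%E.
Proof.
move=> hV; apply: ge_ereal_sup => _ [_ [l pl <-] <-]; rewrite lee_fin.
elim: l a pl hV => [|y l ih] x pl hV.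
  by rewrite (itv_partition_nil pl) subrr /variation big_nil.
rewrite variation_cons.
have [/= /andP[xy _] _] := pl.
have pl' := itv_partition_cons pl.
have ys : y <= s := itv_partition_le pl'.
have := hV x y (lexx x) (ltW xy) ys.
have := ih y pl' (fun u v yu uv vs => hV u v (le_trans (ltW xy) yu) uv vs).
by lra.
Qed.

Section Optimality.
Variables (R : realType) (a b c : R) (f : R -> R) (up : bool).
Hypotheses (c0 : 0 < c) (cf : cadlag_on a b f).

Notation in_stage := (in_stage a b c f up).
Notation gap := (gap a b c f up).
Notation top := (top a b c f up).
Notation level := (level a b c f up).
Notation climb := (climb a b c f up).
Notation signed := (signed f up).
Notation dir := (dir R up).

Definition completed (w : nat -> R) (j : nat) : R :=
  \sum_(0 <= k < j) w k.+1 * gap k.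

Lemma climbS (w : nat -> R) (j : nat) (s : R) :
  climb w j.+1 s = completed w j + w j.+1 * (top j + level j.+1 s - c).
Proof. by []. Qed.

Lemma completedS (w : nat -> R) (j : nat) :
  completed w j.+1 = completed w j + w j.+1 * gap j.
Proof. by rewrite /completed big_nat_recr. Qed.

(** At a point of stage [j] the sum differs from its value for [j] completed
    stages by at most what [level j] still has to gain. *)
Lemma climb_completed_dist (w : nat -> R) (j : nat) (s : R) :
  in_stage j s -> `|w j| = 1 ->
  `|completed w j - climb w j s| <= top j - level j s.
Proof.
move=> sj wj; have lt := level_le_top cf sj.
case: j sj wj lt => [|j] sj wj lt.
  by rewrite /completed big_nil subrr normr0 subr_ge0.
rewrite completedS climbS /gap.
rewrite (_ : _ - _ = w j.+1 * (top j.+1 - level j.+1 s)); last by lra.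
by rewrite normrM wj mul1r ger0_norm// subr_ge0.
Qed.

(** Each increment splits into the rest of the first stage, the full stages in
    between and the beginning of the last stage; on each of these pieces the
    increment for the weights [dir] is a signed sum of the nonnegative terms
    whose sum is the increment for the weights 1. *)
Lemma climb_increment_le (i j : nat) (u s : R) :
  in_stage i u -> in_stage j s -> u <= s ->
  `|climb dir j s - climb dir i u| <=
  climb (fun=> 1) j s - climb (fun=> 1) i u.
Proof.
move=> ui sj us; have := in_stage_le ui sj us.
rewrite leq_eqVlt => /orP[/eqP ij|].
  subst i; case: j ui sj => [|j] ui sj; first by rewrite !subrr normr0.
  have lus := level_homo cf ui sj us.
  rewrite !climbS; have [->|->] := dir_cases R up j.+1;
    by rewrite ler_norml; apply/andP; split; lra.
case: j sj => [//|j] sj; rewrite ltnS => ij.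
have finish : `|completed dir i - climb dir i u| <=
    completed (fun=> 1) i - climb (fun=> 1) i u.
  have := level_le_top cf ui; case: (i) ui => [|k] ui lt.
    by rewrite /completed !big_nil !subrr normr0.
  rewrite !completedS !climbS /gap.
  have [->|->] := dir_cases R up k.+1;
    by rewrite ler_norml; apply/andP; split; lra.
have between : `|completed dir j - completed dir i| <=
    completed (fun=> 1) j - completed (fun=> 1) i.
  elim: j s {us} sj {finish} ij => [|j ih] s sj.
    by rewrite leqn0 => /eqP ->; rewrite !subrr normr0.
  rewrite leq_eqVlt => /orP[/eqP ->|]; first by rewrite !subrr normr0.
  rewrite ltnS => ij; have [t tj ts] := in_stage_pred c0 cf sj (leqnSn _).
  have := gap_ge0 c0 cf tj; have := ih t tj ij.
  rewrite !completedS /= !ler_norml => /andP[? ?] ?.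
  have [->|->] := dir_cases R up j.+1; apply/andP; split; lra.
have := step_ge0 c0 cf sj.
rewrite !climbS /=; move: finish between; rewrite !ler_norml.
move=> /andP[? ?] /andP[? ?] step0.
have [->|->] := dir_cases R up j.+1; by apply/andP; split; lra.
Qed.

Variable g : R -> R.
Hypothesis close_increments : forall u s, a <= u -> u < s -> s <= b ->
  `|(g s - g u) - (f s - f u)| <= c.

(** On stage 0 this is |g(s) - g(a)| <= TV(g, [a; s]). Afterwards, take [t] in
    the preceding stage and [s'] in the current one where the suprema are almost
    attained: the path from [t] through [s'] to [s] adds |g(s') - g(t)|, where
    [g] makes at least the step in the right direction up to a small error, and
    |g(s) - g(s')|, which pays for whatever [g] does after [s']. *)
Lemma climb_le_total_variation (j : nat) (s : R) : in_stage j s ->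
  ((climb (fun=> 1) j s + `|g s - g a - climb dir j s|)%:E <=
   total_variation a s g)%E.
Proof.
elim: j s => [|j ih] s sj.
  have [/andP[as_ _] _] := sj.
  by rewrite /= add0r subr0 total_variation_ge.
have [/andP[as_ sb] _] := sj.
apply/lee_addgt0Pr => e e0.
(* The error [d] enters once through [tot], once through [net] and four times
   through [move_toward]. *)
pose d := e / 6.
have d0 : 0 < d by rewrite divr_gt0.
have [s' [s'j s's levs]] := level_approx sj d0.
have [t0 t0j t0s] := in_stage_pred c0 cf sj (leqnSn _).
have [t tj topt] := top_approx t0j d0.
have ts' : t < s'.
  rewrite ltNge; apply/negP => s't.
  by have := in_stage_le s'j tj s't; rewrite ltnn.
have [/andP[at_ tb] _] := tj.
have s'b : s' <= b := le_trans s's sb.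
rewrite (total_variationD g (le_trans at_ (ltW ts')) s's).
rewrite (total_variationD g at_ (ltW ts')).
apply: (@le_trans _ _ ((climb (fun=> 1) j t + `|g t - g a - climb dir j t|
    + `|g s' - g t| + `|g s - g s'|) + e)%:E); last first.
  rewrite EFinD leeD2r// 2!EFinD !leeD ?ih ?total_variation_ge//.
  exact: ltW.
rewrite lee_fin.
have step0 := step_ge0 c0 cf sj.
have levt := level_ge cf tj.
have tot := climb_completed_dist tj (normr1 R).
have net := climb_completed_dist tj (normr_dir R up j).
rewrite !climbS /=.
set step := top j + level j.+1 s - c in step0 *.
have move_toward : `|(g s' - g t) - dir j.+1 * step| <=
    `|g s' - g t| - step + 4 * d.
  have := close_increments at_ ts' s'b; rewrite ler_norml => /andP[lo hi].
  have st : signed j t = - (dir j.+1 * f t) by rewrite dirS mulNr opprK.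
  move: levs topt; rewrite st /signed /step.
  have [->|->] := dir_cases R up j.+1 => levs topt; rewrite ler_norml.
    by have nx := ler_norm (g s' - g t); apply/andP; split; lra.
  have nx := ler_norm (- (g s' - g t)); rewrite normrN in nx.
  by apply/andP; split; lra.
have tri : `|g s - g a - (completed dir j + dir j.+1 * step)| <=
    `|g t - g a - climb dir j t| + `|completed dir j - climb dir j t|
    + `|(g s' - g t) - dir j.+1 * step| + `|g s - g s'|.
  rewrite [`|completed _ _ - _|]distrC.
  rewrite (_ : g s - g a - _ = (g t - g a - climb dir j t)
    + (climb dir j t - completed dir j) + ((g s' - g t) - dir j.+1 * step)
    + (g s - g s')); last by lra.
  by do 2![apply: le_trans (ler_normD _ _) _; rewrite lerD2r]; exact: ler_normD.
have := ler_norm (completed (fun=> 1) j - climb (fun=> 1) j t).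
by rewrite /d in levs topt move_toward *; lra.
Qed.

End Optimality.

(** * Optimality and uniqueness *)

Section Conclusion.
Variables (R : realType) (a b c : R) (f : R -> R).
Hypotheses (ab : a < b) (c0 : 0 < c) (cf : cadlag_on a b f).

Lemma total_variation_fic_le (s : R) : a <= s <= b ->
  (total_variation a s (fic a b c f) <= (fU a b c f s + fD a b c f s)%:E)%E.
Proof.
move=> /andP[as_ sb].
pose V x := fU a b c f x + fD a b c f x.
have V0 : V a = 0.
  have a0 : in_stage a b c f (starts_up a b c f) 0 a.
    by apply: in_stage_start => //; exact: ltW.
  by rewrite /V (fU_fD_climb ab a0).
rewrite -[X in X%:E]subr0 -V0.
apply: total_variation_le_increment => x y ax xy ys.
have yb := le_trans ys sb.
have [i xi] : exists i, in_stage a b c f (starts_up a b c f) i x.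
  by apply: in_stage_ex => //; rewrite ax (le_trans xy).
have [j yj] : exists j, in_stage a b c f (starts_up a b c f) j y.
  by apply: in_stage_ex => //; rewrite yb (le_trans ax).
rewrite /V (fU_fD_climb ab xi) (fU_fD_climb ab yj).
by rewrite (fic_climb ab xi) (fic_climb ab yj) climb_increment_le.
Qed.

Lemma le_total_variation_fic (g : R -> R) (s : R) :
  (increment_dist a b g f <= c%:E)%E -> a <= s <= b ->
  ((fU a b c f s + fD a b c f s + `|g s - g a - fic a b c f s|)%:E <=
   total_variation a s g)%E.
Proof.
move=> gf sab.
have [j sj] := in_stage_ex (starts_up a b c f) c0 cf sab.
rewrite (fU_fD_climb ab sj) (fic_climb ab sj).
apply: climb_le_total_variation sj => // u v au uv vb.
rewrite -lee_fin; apply: le_trans gf; apply: ereal_sup_ubound.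
by exists (u, v).
Qed.

End Conclusion.

Theorem corollary2p2 (R : realType) (a b c : R) (f g : R -> R) :
  a < b -> 0 < c -> cadlag_on a b f ->
  (increment_dist a b g f <= c%:E)%E ->
  total_variation a b g \is a fin_num ->
  (forall s, a <= s <= b ->
     (total_variation a s (fic a b c f) <= total_variation a s g)%E) /\
  (g a = 0 ->
   (forall s, a <= s <= b ->
     (total_variation a s g <= total_variation a s (fic a b c f))%E) ->
   forall s, a <= s <= b -> g s = fic a b c f s).
Proof.
move=> ab c0 cf gf _.
split=> [s sab|ga gopt s sab].
  apply: le_trans (total_variation_fic_le ab c0 cf sab) _.
  apply: le_trans (le_total_variation_fic ab c0 cf gf sab).
  by rewrite lee_fin lerDl.
have := le_trans (le_total_variation_fic ab c0 cf gf sab)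
  (le_trans (gopt s sab) (total_variation_fic_le ab c0 cf sab)).
by rewrite lee_fin gerDl normr_le0 ga subr0 subr_eq0 => /eqP.
Qed.
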